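(* Let $X$ be a pointed metric space and $E$ a Banach space over $\mathbb{K}$. Then $\pi$ is a uniform and dualizable Lipschitz cross-norm on $X\boxtimes E$ such that $L\leq\pi$.
   Context: $\mathbb{K}$ is $\mathbb{R}$ or $\mathbb{C}$. A pointed metric space $X$ is a metric space (with metric $d$) with a distinguished base point $0$. For pointed metric spaces $X,Y$ (a Banach space being pointed by its zero vector), $\mathrm{Lip}_0(X,Y)$ is the set of all Lipschitz maps $f\colon X\to Y$ with $f(0)=0$, and $\mathrm{Lip}(f)$ is the least Lipschitz constant; $X^\#=\mathrm{Lip}_0(X,\mathbb{K})$. $E^*$ is the topological dual of $E$ and $\langle\phi,e\rangle=\phi(e)$; $V'$ denotes the algebraic dual of a vector space $V$; $\mathcal{L}(E;E)$ is the space of bounded linear operators on $E$. For $x,y\in X$ and $e\in E$, $\delta_{(x,y)}\boxtimes e\in \mathrm{Lip}_0(X,E^* )'$ is the linear functional $f\mapsto\langle f(x)-f(y),e\rangle$. The Lipschitz tensor product $X\boxtimes E$ is the linear subspace of $\mathrm{Lip}_0(X,E^* )'$ spanned by all the functionals $\delta_{(x,y)}\boxtimes e$ with $x,y\in X$, $e\in E$. Every $u\in X\boxtimes E$ can be written (non-uniquely) as $u=\sum_{i=1}^n\delta_{(x_i,y_i)}\boxtimes e_i$. For $u\in X\boxtimes E$, the Lipschitz projective norm is $$\pi(u)=\inf\left\{\sum_{i=1}^n d(x_i,y_i)\|e_i\|\colon u=\sum_{i=1}^n\delta_{(x_i,y_i)}\boxtimes e_i\right\},$$ the infimum being over all representations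 of $u$, and, for $u=\sum_{i=1}^n \delta_{(x_i,y_i)}\boxtimes e_i$, $$L(u)=\sup\left\{\left|\sum_{i=1}^n \langle f(x_i)-f(y_i),e_i\rangle\right|\colon f\in\mathrm{Lip}_0(X,E^* ),\ \mathrm{Lip}(f)\leq 1 \right\}.$$ A norm $\alpha$ on $X\boxtimes E$ is a Lipschitz cross-norm if $\alpha(\delta_{(x,y)}\boxtimes e)=d(x,y)\|e\|$ for all $x,y\in X$, $e\in E$. A Lipschitz cross-norm $\alpha$ is dualizable if for all $g\in X^\#$, $\phi\in E^*$ and all $\sum_{i=1}^n\delta_{(x_i,y_i)}\boxtimes e_i\in X\boxtimes E$, $\left|\sum_{i=1}^n(g(x_i)-g(y_i))\langle\phi,e_i\rangle\right|\leq\mathrm{Lip}(g)\|\phi\|\,\alpha\left(\sum_{i=1}^n \delta_{(x_i,y_i)}\boxtimes e_i\right)$. It is uniform if for all $h\in\mathrm{Lip}_0(X,X)$, $T\in\mathcal{L}(E;E)$ and all $\sum_{i=1}^n\delta_{(x_i,y_i)}\boxtimes e_i\in X\boxtimes E$, $\alpha\left(\sum_{i=1}^n\delta_{(h(x_i),h(y_i))}\boxtimes T(e_i)\right)\leq\mathrm{Lip}(h)\|T\|\,\alpha\left(\sum_{i=1}^n \delta_{(x_i,y_i)}\boxtimes e_i\right)$. *)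

(* Defs.v *)
From HB Require Import structures.
From mathcomp Require Import all_boot all_order all_algebra.
From mathcomp Require Import complex.
From mathcomp Require Import all_classical all_reals all_analysis.

Set Implicit Arguments.
Unset Strict Implicit.
Unset Printing Implicit Defensive.

Import Order.TTheory GRing.Theory Num.Theory.
Import numFieldNormedType.Exports.

Local Open Scope classical_set_scope.
Local Open Scope ring_scope.

Variant scalar_kind := RealScalars | ComplexScalars.

Definition scalars (R : realType) (k : scalar_kind) : numFieldType :=
  match k with RealScalars => R | ComplexScalars => R[i] end.

(* The library's norms take values in the field of scalars, hence in R[i] for
   complex spaces; the real-valued norm is recovered through the real part. *)
Definition real_part (R : realType) (k : scalar_kind) : scalars R k -> R :=
  match k with
  | RealScalars => fun x : R => x
  | ComplexScalars => fun z : R[i] => complex.Re z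
  end.

Section RealNorm.
Variables (R : realType) (k : scalar_kind).
Local Notation K := (scalars R k).

Definition rnorm (V : normedModType K) (v : V) : R := real_part `|v|.

Definition ndist (V : normedModType K) (u v : V) : R := rnorm (u - v).

(* Meaningful for bounded linear T only: sup is 0 on unbounded sets. *)
Definition opnorm (V W : normedModType K) (T : V -> W) : R :=
  sup [set rnorm (T v) | v in [set v | rnorm v <= 1]].

Lemma real_partD (a b : K) : real_part (a + b) = real_part a + real_part b.
Proof. by move: a b; rewrite /real_part; case: k => // -[? ?] [? ?]. Qed.

Lemma real_partM (a b : K) : 0 <= a -> 0 <= b ->
  real_part (a * b) = real_part a * real_part b.
Proof.
move: a b; rewrite /real_part; case: k => // -[a a'] [b b'].
rewrite /= !lecE /= => /andP[/eqP-> _] /andP[/eqP-> _].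
by rewrite mul0r subr0.
Qed.

Lemma real_part_le (a b : K) : a <= b -> real_part a <= real_part b.
Proof.
move: a b; rewrite /real_part; case: k => // -[a a'] [b b'].
by rewrite /= lecE => /andP[].
Qed.

Lemma real_part0 : real_part (0 : K) = 0.
Proof. by rewrite /real_part; case: k. Qed.

Lemma rnorm_ge0 (V : normedModType K) (v : V) : 0 <= rnorm v.
Proof. by rewrite /rnorm -real_part0 real_part_le. Qed.

Lemma rnorm0 (V : normedModType K) : rnorm (0 : V) = 0.
Proof. by rewrite /rnorm normr0 real_part0. Qed.

Lemma rnormD (V : normedModType K) (u v : V) :
  rnorm (u + v) <= rnorm u + rnorm v.
Proof. by rewrite /rnorm -real_partD real_part_le// ler_normD. Qed.

Lemma rnormZ (V : normedModType K) (a : K) (v : V) :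
  rnorm (a *: v) = rnorm (a : K^o) * rnorm v.
Proof. by rewrite /rnorm normrZ real_partM. Qed.

End RealNorm.


Section Span.
Variables (K : numFieldType) (V : lmodType K).

Definition span (S : set V) : set V :=
  [set v | exists (n : nat) (c : 'I_n -> K) (s : 'I_n -> V),
     (forall i, S (s i)) /\ v = \sum_i c i *: s i].

Lemma span_submod_closed (S : set V) : submod_closed (mem (span S)).
Proof.
split=> [|a u v].
  by rewrite inE; exists 0, (fun=> 0), (fun=> 0); rewrite big_ord0; split=> // -[].
rewrite !inE => -[m [c [s [Ss ->]]]] [n [d [t [St ->]]]].
exists (m + n)%N, (fun i => match fintype.split i with inl j => a * c j | inr j => d j end),
  (fun i => match fintype.split i with inl j => s j | inr j => t j end).
split=> [i|]; first by case: fintype.split.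
rewrite big_split_ord/= scaler_sumr; congr (_ + _); apply: eq_bigr => i _.
  by rewrite (unsplitK (inl i)) scalerA.
by rewrite (unsplitK (inr i)).
Qed.

Lemma mem_span (S : set V) (v : V) : S v -> v \in mem (span S).
Proof.
move=> Sv; rewrite inE; exists 1%N, (fun=> 1), (fun=> v).
by rewrite big_ord1 scale1r.
Qed.

End Span.

Section AlgebraicDual.
Variables (K : numFieldType) (V : lmodType K).

Definition is_linear_form : {pred V -> K^o} :=
  mem [set phi : V -> K^o | linear phi].

Lemma linear_form_submod_closed : submod_closed is_linear_form.
Proof.
split=> [|a phi psi]; rewrite !inE.
  by move=> c u v; rewrite /= scaler0 addr0.
move=> lphi lpsi c u v.
by rewrite -[LHS]/(a *: phi (c *: u + v) + psi (c *: u + v)) lphi lpsi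
  !scalerDr !scalerA (mulrC a) addrACA.
Qed.
HB.instance Definition _ :=
  GRing.isSubmodClosed.Build K (V -> K^o) is_linear_form
    linear_form_submod_closed.

Record alg_dual := AlgDual {
  alg_dual_fun :> V -> K^o;
  _ : alg_dual_fun \in is_linear_form }.
HB.instance Definition _ := [isSub for alg_dual_fun].
HB.instance Definition _ := [Choice of alg_dual by <:].
HB.instance Definition _ := [SubChoice_isSubLmodule of alg_dual by <:].

End AlgebraicDual.

Section TopologicalDual.
Variables (R : realType) (k : scalar_kind).
Local Notation K := (scalars R k).
Variable E : normedModType K.

Definition is_continuous_form : {pred E -> K^o} :=
  mem [set phi : E -> K^o | linear phi /\ continuous phi].

Lemma continuous_form_submod_closed : submod_closed is_continuous_form.
Proof.
split=> [|a phi psi]; rewrite !inE.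
  split; first by move=> c u v; rewrite /= scaler0 addr0.
  by move=> x; exact: cvg_cst.
move=> [lphi cphi] [lpsi cpsi]; split.
  have := linear_form_submod_closed E => -[_ /(_ a phi psi)].
  by rewrite !inE; exact.
by move=> x; apply: (@cvgD K K^o); [apply: cvgZl_tmp; exact: cphi|exact: cpsi].
Qed.
HB.instance Definition _ :=
  GRing.isSubmodClosed.Build K (E -> K^o) is_continuous_form
    continuous_form_submod_closed.

Record dual := Dual {
  dual_fun :> E -> K^o;
  _ : dual_fun \in is_continuous_form }.
HB.instance Definition _ := [isSub for dual_fun].
HB.instance Definition _ := [Choice of dual by <:].
HB.instance Definition _ := [SubChoice_isSubLmodule of dual by <:].


Definition dnorm (phi : dual) : R := opnorm (val phi).

Definition ddist (phi psi : dual) : R := dnorm (phi - psi).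

Lemma dual_linear (phi : dual) : linear (val phi).
Proof. by have := valP phi; rewrite inE => -[]. Qed.

Lemma dual_continuous (phi : dual) : continuous (val phi).
Proof. by have := valP phi; rewrite inE => -[]. Qed.

Lemma dnorm_has_sup (phi : dual) :
  has_sup [set rnorm (val phi v) | v in [set v | rnorm v <= 1]].
Proof.
split; first by exists (rnorm (val phi 0)), 0; rewrite //= rnorm0.
pose f : {linear E -> K^o} :=
  HB.pack (val phi) (GRing.isLinear.Build _ _ _ _ _ (dual_linear phi)).
have /linear_boundedP/pinfty_ex_gt0[r r0 fr] : bounded_near f (nbhs 0).
  exact/linear_bounded_continuous/dual_continuous.
exists (real_part r) => _ [v /= v1 <-].
apply: (le_trans (real_part_le (fr v))); rewrite real_partM//; last exact: ltW.
by rewrite -[leRHS]mulr1 ler_wpM2l// -(real_part0 R k); exact/real_part_le/ltW.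
Qed.

Lemma dnorm_ge (phi : dual) (v : E) :
  rnorm v <= 1 -> rnorm (val phi v) <= dnorm phi.
Proof.
by move=> v1; apply: (sup_upper_bound (dnorm_has_sup phi)); exists v.
Qed.

Lemma dnorm_le (phi : dual) (C : R) :
  (forall v, rnorm v <= 1 -> rnorm (val phi v) <= C) -> dnorm phi <= C.
Proof.
move=> phiC; apply: ge_sup; first by case: (dnorm_has_sup phi).
by move=> _ [v /= v1 <-]; exact: phiC.
Qed.

Lemma dnorm_ge0 (phi : dual) : 0 <= dnorm phi.
Proof.
by rewrite (le_trans (rnorm_ge0 (val phi 0)))// dnorm_ge// rnorm0.
Qed.

Lemma dnorm0 : dnorm 0 = 0.
Proof.
by apply/eqP; rewrite eq_le dnorm_ge0 dnorm_le// => v _; rewrite [val _ _]/= rnorm0.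
Qed.

Lemma dnorm_linear (a : K) (phi psi : dual) :
  dnorm (a *: phi + psi) <= rnorm (a : K^o) * dnorm phi + dnorm psi.
Proof.
apply: dnorm_le => v v1.
rewrite [val _ _]/= (le_trans (rnormD _ _))// lerD ?dnorm_ge//.
by rewrite rnormZ ler_wpM2l ?rnorm_ge0 ?dnorm_ge.
Qed.

End TopologicalDual.

Section LipschitzMaps.
Variables (R : realType) (X : metricType R) (x0 : X).

Definition lipschitz_const (Y : Type) (d : Y -> Y -> R) (f : X -> Y) : set R :=
  [set C | 0 <= C /\ forall x y, d (f x) (f y) <= C * mdist x y].

Definition Lip (Y : Type) (d : Y -> Y -> R) (f : X -> Y) : R :=
  inf (lipschitz_const d f).

Definition lip0 (Y : Type) (d : Y -> Y -> R) (y0 : Y) : set (X -> Y) :=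
  [set f | lipschitz_const d f !=set0 /\ f x0 = y0].

End LipschitzMaps.

Section TensorProduct.
Variables (R : realType) (k : scalar_kind).
Local Notation K := (scalars R k).
Variables (X : metricType R) (x0 : X) (E : normedModType K).

Definition is_lip0_dual : {pred X -> dual E} := mem (lip0 x0 (@ddist R k E) 0).

Lemma lip0_dual_submod_closed : submod_closed is_lip0_dual.
Proof.
split=> [|a f g]; rewrite !inE.
  split=> //; exists 0; split=> // x y.
  by rewrite /ddist subrr dnorm0 mul0r.
move=> [[C [C0 fC]] f0] [[D [D0 gD]] g0]; split; last first.
  by rewrite -[LHS]/(a *: f x0 + g x0) f0 g0 scaler0 addr0.
exists (rnorm (a : K^o) * C + D); split=> [|x y].
  by rewrite addr_ge0// mulr_ge0// rnorm_ge0.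
rewrite /ddist -[X in dnorm X]/((a *: f x + g x) - (a *: f y + g y)).
rewrite opprD addrACA -scalerBr (le_trans (dnorm_linear _ _ _))//.
by rewrite mulrDl lerD ?gD// -mulrA ler_wpM2l ?rnorm_ge0 ?fC.
Qed.
HB.instance Definition _ :=
  GRing.isSubmodClosed.Build K (X -> dual E) is_lip0_dual
    lip0_dual_submod_closed.

Record lip0_dual := Lip0Dual {
  lip0_dual_fun :> X -> dual E;
  _ : lip0_dual_fun \in is_lip0_dual }.
HB.instance Definition _ := [isSub for lip0_dual_fun].
HB.instance Definition _ := [Choice of lip0_dual by <:].
HB.instance Definition _ := [SubChoice_isSubLmodule of lip0_dual by <:].

Definition delta_fun (x y : X) (e : E) : lip0_dual -> K^o :=
  fun f => (f x - f y : dual E) e.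

Lemma delta_fun_linear (x y : X) (e : E) :
  delta_fun x y e \in @is_linear_form K lip0_dual.
Proof.
by rewrite inE => a f g; rewrite /delta_fun /= scalerBr opprD addrACA.
Qed.

Definition delta_form (x y : X) (e : E) : alg_dual lip0_dual :=
  Sub (delta_fun x y e) (delta_fun_linear x y e).

Definition is_lip_tensor : {pred alg_dual lip0_dual} :=
  mem (span [set u | exists x y e, u = delta_form x y e]).

HB.instance Definition _ :=
  GRing.isSubmodClosed.Build K (alg_dual lip0_dual) is_lip_tensor
    (span_submod_closed _).

Record lip_tensor := LipTensor {
  lip_tensor_form :> alg_dual lip0_dual;
  _ : lip_tensor_form \in is_lip_tensor }.
HB.instance Definition _ := [isSub for lip_tensor_form].
HB.instance Definition _ := [Choice of lip_tensor by <:].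
HB.instance Definition _ := [SubChoice_isSubLmodule of lip_tensor by <:].

Lemma delta_form_tensor (x y : X) (e : E) : delta_form x y e \in is_lip_tensor.
Proof. by apply: mem_span; exists x, y, e. Qed.

Definition delta (x y : X) (e : E) : lip_tensor :=
  Sub (delta_form x y e) (delta_form_tensor x y e).

Definition pairing (u : lip_tensor) (f : lip0_dual) : K := u f.

Definition tensor_sum (n : nat) (x y : 'I_n -> X) (e : 'I_n -> E) : lip_tensor :=
  \sum_(i < n) delta (x i) (y i) (e i).

Lemma pairing_tensor_sum (n : nat) (x y : 'I_n -> X) (e : 'I_n -> E)
    (f : lip0_dual) :
  pairing (tensor_sum x y e) f =
  \sum_(i < n) (f (x i) - f (y i) : dual E) (e i).
Proof.
exact: (big_morph (fun u => pairing u f) (id1 := 0) (op1 := +%R)).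
Qed.


End TensorProduct.

Section Norms.
Variables (R : realType) (k : scalar_kind).
Local Notation K := (scalars R k).

Definition is_norm (V : lmodType K) (alpha : V -> R) : Prop :=
  [/\ forall u, 0 <= alpha u,
      forall u, alpha u = 0 -> u = 0,
      forall (c : K) u, alpha (c *: u) = rnorm (c : K^o) * alpha u &
      forall u v, alpha (u + v) <= alpha u + alpha v].

Variables (X : metricType R) (x0 : X) (E : normedModType K).
Local Notation T := (lip_tensor x0 E).

Definition lip_proj_norm (u : T) : R :=
  inf [set r | exists (n : nat) (x y : 'I_n -> X) (e : 'I_n -> E),
    u = tensor_sum x0 x y e /\ r = \sum_(i < n) mdist (x i) (y i) * rnorm (e i)].

(* By pairing_tensor_sum, |pairing u f| is the modulus of the sum of the
   <f(x_i) - f(y_i), e_i> for every representation of u. *)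
Definition lip_inj_norm (u : T) : R :=
  sup [set rnorm (pairing u f : K^o) | f in
    [set f : lip0_dual x0 E | Lip (@ddist R k E) f <= 1]].

Definition lip_cross_norm (alpha : T -> R) : Prop :=
  is_norm alpha /\
  forall (x y : X) (e : E), alpha (delta x0 x y e) = mdist x y * rnorm e.

Definition dualizable (alpha : T -> R) : Prop :=
  forall (g : X -> K^o) (phi : dual E),
  lip0 x0 (@ndist R k K^o) 0 g ->
  forall (n : nat) (x y : 'I_n -> X) (e : 'I_n -> E),
  rnorm (\sum_(i < n) (g (x i) - g (y i)) * phi (e i) : K^o) <=
    Lip (@ndist R k K^o) g * dnorm phi * alpha (tensor_sum x0 x y e).

(* For a linear map, boundedness near 0 is the existence of r such that
   |S v| <= r * |v| for all v (linear_boundedP). *)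
Definition uniform_cross_norm (alpha : T -> R) : Prop :=
  forall (h : X -> X) (S : {linear E -> E}),
  lip0 x0 mdist x0 h -> bounded_near S (nbhs (0 : E)) ->
  forall (n : nat) (x y : 'I_n -> X) (e : 'I_n -> E),
  alpha (tensor_sum x0 (h \o x) (h \o y) (S \o e)) <=
    Lip mdist h * opnorm S * alpha (tensor_sum x0 x y e).

End Norms.

(* Main.v *)
Require Import Defs.
From HB Require Import structures.
From mathcomp Require Import all_boot all_order all_algebra.
From mathcomp Require Import complex.
From mathcomp Require Import all_classical all_reals all_analysis.
From mathcomp Require Import lra ring.

(** Every pairing of a tensor [u] with an [E^*]-valued Lipschitz map [f] obeys
    |<u, f>| <= Lip(f) * pi(u) (lemma [pairing_le_proj_norm]): for each
    representation of [u] the modulus of the pairing is at most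
    Lip(f) * sum d(x_i, y_i) |e_i|, and one takes the infimum over
    representations. Three parts of the theorem are instances of this bound.
    It gives L <= pi at once; it gives definiteness of pi, because a tensor is a
    functional on the Lipschitz maps, hence zero as soon as all its pairings
    vanish; and applied to the rank-one map f(x) = g(x) phi, whose Lipschitz
    constant is at most Lip(g) |phi|, it is dualizability.

    The remaining norm axioms and uniformity are transformations of
    representations: scaling the vectors, concatenating two representations,
    replacing (x_i, y_i, e_i) by (h(x_i), h(y_i), S(e_i)). For the last one it
    matters that representations of the same tensor go to representations of
    the same tensor: pairing the transformed sum with [f] is pairing the
    original one with x |-> S^*(f(h(x))), which is again Lipschitz and
    null at the base point (lemma [pairing_pullback]).

    The only deep point is the cross-norm inequality pi(u) >= d(x, y) |e| for
    the elementary tensor u of x, y and e. It follows from dualizability with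
    g = d(-, y) - d(x0, y) and a functional phi of norm at most 1 such that
    |phi(e)| = |e|. The existence of phi is the Hahn-Banach theorem, which is
    proved first, for sublinear functionals on real vector spaces: by Zorn's
    lemma there is a minimal sublinear functional below the given one, and
    minimal sublinear functionals are linear. Complex scalars are handled by
    restricting scalars to the reals and recovering a complex-linear form from
    its real part. *)

Set Implicit Arguments.
Unset Strict Implicit.
Unset Printing Implicit Defensive.

Import Order.TTheory GRing.Theory Num.Theory.
Import numFieldNormedType.Exports.

Local Open Scope classical_set_scope.
Local Open Scope ring_scope.

(** * Hahn-Banach theorem for sublinear functionals *)

Section HahnBanach.
Variables (R : realType) (V : lmodType R).
Implicit Types (p q : V -> R) (u v a : V).

(** Homogeneity is required as an inequality only, which is what survives
    infima directly; equality is [sublinearZ]. *)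
Definition sublinear p :=
  (forall u v, p (u + v) <= p u + p v) /\
  (forall t u, 0 <= t -> p (t *: u) <= t * p u).

Lemma sublinear0 p : sublinear p -> p 0 = 0.
Proof.
move=> [pD pZ]; apply/eqP; rewrite eq_le; apply/andP; split.
  by have := pZ 0 0 (lexx 0); rewrite scale0r mul0r.
by have := pD 0 0; rewrite addr0 lerDl.
Qed.

Lemma sublinearZ p t u : sublinear p -> 0 <= t -> p (t *: u) = t * p u.
Proof.
move=> psub; rewrite le_eqVlt => /predU1P[<-|t0].
  by rewrite scale0r mul0r sublinear0.
apply/eqP; rewrite eq_le psub.2 ?(ltW t0)//= -ler_pdivlMl//.
have := psub.2 t^-1 (t *: u); rewrite scalerA mulVf ?gt_eqF// scale1r.
by apply; rewrite invr_ge0 ltW.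
Qed.

Lemma sublinear_geN p u : sublinear p -> - p (- u) <= p u.
Proof.
move=> psub; rewrite lerNl -subr_ge0 opprK -(sublinear0 psub) -(addNr u).
exact: psub.1.
Qed.

(** The largest sublinear functional below [p] that is at most [- p a] at
    [- a], obtained by comparing [p] with its translates along [a]. It is used
    twice: to force the value at one vector in the Hahn-Banach theorem, and to
    show that a minimal sublinear functional cannot be tilted any further, hence
    is additive. *)
Definition tilt p a u : R :=
  inf [set p (u + t *: a) - t * p a | t in [set t | 0 <= t]].

Lemma tilt_le p a u t : sublinear p -> 0 <= t ->
  tilt p a u <= p (u + t *: a) - t * p a.
Proof.
move=> psub t0; apply: ge_inf; last by exists t.
exists (- p (- u)) => _ [s /= s0 <-].
rewrite -(sublinearZ a psub s0) lerBrDr.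
have := psub.1 (u + s *: a) (- u); rewrite addrAC subrr add0r; lra.
Qed.

Lemma le_tilt p a u m :
  (forall t, 0 <= t -> m <= p (u + t *: a) - t * p a) -> m <= tilt p a u.
Proof.
move=> pm; apply: lb_le_inf; first by exists (p (u + 0 *: a) - 0 * p a), 0 => /=.
by move=> _ [t /= t0 <-]; exact: pm.
Qed.

Lemma tilt_sublinear p a : sublinear p -> sublinear (tilt p a).
Proof.
move=> psub; split=> [u v|t u].
  rewrite -lerBlDr; apply: le_tilt => s s0.
  rewrite lerBlDr -lerBlDl; apply: le_tilt => t t0; rewrite lerBlDl.
  have := tilt_le a (u + v) psub (addr_ge0 s0 t0).
  have := psub.1 (u + s *: a) (v + t *: a).
  rewrite addrACA -scalerDl mulrDl; lra.
rewrite le_eqVlt => /predU1P[<-|t0].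
  rewrite scale0r mul0r (le_trans (tilt_le a 0 psub (lexx 0)))//.
  by rewrite scale0r addr0 mul0r subr0 sublinear0.
rewrite -ler_pdivrMl//; apply: le_tilt => s s0; rewrite ler_pdivrMl//.
have ts0 : 0 <= t * s by rewrite mulr_ge0// ltW.
have := tilt_le a (t *: u) psub ts0.
by rewrite -scalerA -scalerDr (sublinearZ _ psub (ltW t0)) -mulrA -mulrBr.
Qed.

Lemma tilt_le_id p a u : sublinear p -> tilt p a u <= p u.
Proof.
move=> psub; rewrite (le_trans (tilt_le a u psub (lexx 0)))//.
by rewrite scale0r addr0 mul0r subr0.
Qed.

Lemma tilt_opp p a : sublinear p -> tilt p a (- a) <= - p a.
Proof.
move=> psub; rewrite (le_trans (tilt_le a (- a) psub ler01))//.
by rewrite scale1r addNr sublinear0// sub0r mul1r.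
Qed.

Definition minimal_sublinear q := sublinear q /\
  forall r, sublinear r -> (forall u, r u <= q u) -> forall u, q u <= r u.

(** Minimality gives [q <= tilt q v], and the term of parameter 1 in the infimum
    defining [tilt q v u] is [q (u + v) - q v]: this is the missing half of
    additivity. *)
Lemma minimal_sublinear_linear q : minimal_sublinear q -> linear (q : V -> R^o).
Proof.
move=> [qsub qmin].
have qD u v : q (u + v) = q u + q v.
  apply/eqP; rewrite eq_le qsub.1/=.
  have /(_ u) := qmin _ (tilt_sublinear v qsub) (fun u => tilt_le_id v u qsub).
  move=> /le_trans/(_ (tilt_le v u qsub ler01)).
  by rewrite scale1r mul1r lerBrDr.
have qN u : q (- u) = - q u.
  by apply/eqP; rewrite -subr_eq0 opprK -qD addNr sublinear0.
move=> t u v; rewrite qD; congr (_ + _).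
have [t0|/ltW t0] := leP 0 t; first exact: sublinearZ.
rewrite -[t in LHS]opprK scaleNr qN (sublinearZ _ qsub) ?oppr_ge0//.
by rewrite mulNr opprK.
Qed.

(** Zorn's lemma for the reversed pointwise order. The pointwise infimum of a
    chain is finite because every sublinear [q <= p] satisfies
    [q u >= - p (- u)]. *)
Lemma exists_minimal_sublinear p : sublinear p ->
  exists2 q, minimal_sublinear q & forall u, q u <= p u.
Proof.
move=> psub.
pose T := {q : V -> R | sublinear q /\ forall u, q u <= p u}.
pose above (q r : T) := `[< forall u, sval r u <= sval q u >].
have p0 : T by exists p.
have [||A Atot|[q [qsub qp]] qmax] := @ZL_preorder T p0 above.
- by move=> q; apply/asboolP.
- move=> r s t /asboolP rs /asboolP st; apply/asboolP => u.
  exact: le_trans (st u) (rs u).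
- have [[q0 Aq0]|A0] := pselect (A !=set0); last first.
    by exists p0 => q Aq; case: A0; exists q.
  pose m u := inf [set sval q u | q in A].
  have m_le (q : T) u : A q -> m u <= sval q u.
    move=> Aq; apply: ge_inf; last by exists q.
    exists (- p (- u)) => _ [r Ar <-]; have [rsub rp] := svalP r.
    by rewrite (le_trans _ (sublinear_geN u rsub))// lerN2.
  have le_m c u : (forall q : T, A q -> c <= sval q u) -> c <= m u.
    move=> cA; apply: lb_le_inf; first by exists (sval q0 u), q0.
    by move=> _ [q Aq <-]; exact: cA.
  have mD u v : m (u + v) <= m u + m v.
    rewrite -lerBlDr; apply: (le_m) => q Aq; rewrite lerBlDr -lerBlDl.
    apply: (le_m) => r Ar; rewrite lerBlDl.
    (* The smaller of the two members of the chain bounds both terms. *)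
    have [/asboolP rq|/asboolP qr] := Atot q r Aq Ar.
      rewrite (le_trans (m_le r _ Ar))// (le_trans ((svalP r).1.1 _ _))//.
      by rewrite lerD2r.
    rewrite (le_trans (m_le q _ Aq))// (le_trans ((svalP q).1.1 _ _))//.
    by rewrite lerD2l.
  have mZ t u : 0 <= t -> m (t *: u) <= t * m u.
    rewrite le_eqVlt => /predU1P[<-|t0].
      rewrite scale0r mul0r (le_trans (m_le q0 _ Aq0))//.
      by rewrite sublinear0//; exact: (svalP q0).1.
    rewrite -ler_pdivrMl//; apply: (le_m) => q Aq; rewrite ler_pdivrMl//.
    rewrite (le_trans (m_le q _ Aq))// (svalP q).1.2//; exact: ltW.
  have mp u : m u <= p u by rewrite (le_trans (m_le q0 u Aq0))//; exact: (svalP q0).2.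
  exists (exist _ m (conj (conj mD mZ) mp)) => q Aq; apply/asboolP => u.
  exact: m_le.
exists q => //; split=> // r rsub rq.
have rp u : r u <= p u by exact: le_trans (rq u) (qp u).
by have /asboolP := qmax (exist _ r (conj rsub rp)) (asboolT rq).
Qed.

(** A minimal functional below [tilt p a] is at most [- p a] at [- a]; being
    linear, it is at least [p a] at [a]. *)
Theorem hahn_banach_sublinear p a : sublinear p ->
  exists q : V -> R^o, [/\ linear q, forall u, q u <= p u & q a = p a].
Proof.
move=> psub.
have [q qmin qp] := exists_minimal_sublinear (tilt_sublinear a psub).
have qlin := minimal_sublinear_linear qmin.
have qlep u : q u <= p u by exact: le_trans (qp u) (tilt_le_id a u psub).
exists q; split=> //; apply/eqP; rewrite eq_le qlep/=.
have := le_trans (qp _) (tilt_opp a psub); have := sublinear_geN a qmin.1; lra.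
Qed.

End HahnBanach.

(** * Real and complex scalars *)

Section RealScalars.
Variables (R : realType) (k : scalar_kind).
Local Notation K := (scalars R k).

Definition of_real (t : R) : K :=
  match k return scalars R k with
  | RealScalars => t
  | ComplexScalars => (t%:C)%C
  end.

Lemma of_realK : cancel of_real (@real_part R k).
Proof. by rewrite /of_real /real_part; case: k. Qed.

Lemma real_partK (a : K) : 0 <= a -> of_real (real_part a) = a.
Proof.
rewrite /of_real /real_part; move: a; case: k => // -[a b].
by rewrite lecE /= => /andP[/eqP -> _].
Qed.

Lemma of_real_is_zmod_morphism : zmod_morphism of_real.
Proof.
move=> s t; rewrite /of_real; case: k => //.
exact: (rmorphB (real_complex R)).
Qed.

Lemma of_real_is_monoid_morphism : monoid_morphism of_real.
Proof.
split=> [|s t]; rewrite /of_real; case: k => //.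
exact: (rmorphM (real_complex R)).
Qed.

HB.instance Definition _ :=
  GRing.isZmodMorphism.Build R K of_real of_real_is_zmod_morphism.
HB.instance Definition _ :=
  GRing.isMonoidMorphism.Build R K of_real of_real_is_monoid_morphism.

Lemma of_real_ge0 (t : R) : 0 <= t -> 0 <= of_real t.
Proof. by rewrite /of_real; case: k => //; rewrite /= ler0c. Qed.

Lemma real_part_le_rnorm (a : K) : real_part a <= rnorm (a : K^o).
Proof.
rewrite /rnorm /real_part; move: a; case: k => [a|[a b]]; first exact: ler_norm.
rewrite -[leRHS]/(complex.Re `|Complex a b : R[i]|) normc_def /=.
rewrite (le_trans (ler_norm a))//.
by rewrite -sqrtr_sqr ler_wsqrtr// lerDl sqr_ge0.
Qed.

Lemma rnormE (V : normedModType K) (v : V) : `|v| = of_real (rnorm v).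
Proof. by rewrite real_partK. Qed.

Lemma rnorm_of_real (t : R) : rnorm (of_real t : K^o) = `|t|.
Proof.
rewrite /rnorm /of_real /real_part; case: k => //.
by rewrite -[LHS]/(complex.Re `|Complex t 0 : R[i]|) normc_def /= expr0n addr0 sqrtr_sqr.
Qed.

Lemma rnorm1 : rnorm (1 : K^o) = 1.
Proof. by have := rnorm_of_real 1; rewrite rmorph1 normr1. Qed.

Lemma ler_rnorm (V W : normedModType K) (v : V) (w : W) :
  rnorm v <= rnorm w -> `|v| <= `|w|.
Proof.
by move=> vw; rewrite !rnormE -subr_ge0 -rmorphB of_real_ge0// subr_ge0.
Qed.

Lemma rnorm_eq0 (V : normedModType K) (v : V) : rnorm v = 0 -> v = 0.
Proof. by move=> v0; apply/normr0_eq0; rewrite rnormE v0 rmorph0. Qed.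

Lemma rnorm_sum (V : normedModType K) (n : nat) (F : 'I_n -> V) :
  rnorm (\sum_i F i) <= \sum_i rnorm (F i).
Proof.
elim/big_ind2 : _ => [|a b c d ab cd|//]; first by rewrite rnorm0.
by rewrite (le_trans (rnormD _ _))// lerD.
Qed.

End RealScalars.

(** * Complex-linear forms and their real parts *)

(** An alias rather than a second structure on [V] itself, so that the real and
    the given scalar multiplication do not compete when [V] is over [R]. *)
Definition restrict_scalars (R : realType) (k : scalar_kind)
  (V : lmodType (scalars R k)) : Type := V.

Section RestrictScalars.
Variables (R : realType) (k : scalar_kind) (V : lmodType (scalars R k)).
Local Notation VR := (restrict_scalars V).

HB.instance Definition _ := GRing.Zmodule.on VR.

Definition real_scale (t : R) (v : VR) : VR := of_real k t *: (v : V).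

Lemma real_scaleA s t v : real_scale s (real_scale t v) = real_scale (s * t) v.
Proof. by rewrite /real_scale scalerA rmorphM. Qed.

Lemma real_scale1 : left_id 1 real_scale.
Proof. by move=> v; rewrite /real_scale rmorph1 scale1r. Qed.

Lemma real_scaleDr : right_distributive real_scale +%R.
Proof. by move=> t u v; rewrite /real_scale scalerDr. Qed.

Lemma real_scaleDl v : {morph real_scale^~ v : s t / s + t}.
Proof. by move=> s t; rewrite /real_scale rmorphD scalerDl. Qed.

HB.instance Definition _ := GRing.Zmodule_isLmodule.Build R VR
  real_scaleA real_scale1 real_scaleDr real_scaleDl.

Lemma restrict_scaleE (t : R) (v : V) :
  t *: (v : VR) = of_real k t *: v.
Proof. by []. Qed.

End RestrictScalars.

(** Over the complex numbers, the form is phi(v) = q(v) - i q(i v): the imaginary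
    part of a complex-linear phi at [v] is minus its real part at [i v]. *)
Lemma linear_form_of_real_part (R : realType) (k : scalar_kind)
    (V : lmodType (scalars R k)) (q : restrict_scalars V -> R^o) :
  linear q ->
  exists2 phi : V -> (scalars R k)^o, linear phi &
    forall v, real_part (phi v) = q v.
Proof.
case: k V q => V q qlin; first by exists q.
have qD (u v : V) : q (u + v) = q u + q v.
  by have := qlin 1 u v; rewrite !scale1r.
have q0 : q 0 = 0 by apply: (addrI (q 0)); rewrite -qD !addr0.
have qZ (t : R) (v : V) : q ((t%:C)%C *: v) = t * q v.
  by have := qlin t v 0; rewrite !addr0 q0 addr0.
pose im (v : V) := - q ('i%C *: v).
exists (fun v => Complex (q v) (im v)) => // -[a b] u v.
have -> : Complex a b = a%:C%C + b%:C%C * 'i%C :> R[i] by simpc.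
rewrite /im; apply/eqP; rewrite eq_complex /=.
have ii : ('i%C * (a%:C%C + b%:C%C * 'i%C) = - b%:C%C + a%:C%C * 'i%C :> R[i])%R.
  by simpc.
rewrite scalerDr scalerA ii -rmorphN !scalerDl -!scalerA !qD !qZ.
by apply/andP; split; apply/eqP; ring.
Qed.

(** * Bounded operators and norming functionals *)

Section Functionals.
Variables (R : realType) (k : scalar_kind).
Local Notation K := (scalars R k).

Lemma rnorm_sublinear (V : normedModType K) :
  sublinear (@rnorm R k V : restrict_scalars V -> R).
Proof.
split=> [u v|t u t0]; first exact: rnormD.
by rewrite restrict_scaleE rnormZ rnorm_of_real ger0_norm.
Qed.

(** A scalar [c] of modulus 1 turns [phi v] into its modulus, which is therefore
    the real part of [phi (c *: v)]. *)
Lemma linear_form_rnorm_le (V : normedModType K) (phi : V -> K^o) :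
  linear phi -> (forall v, real_part (phi v) <= rnorm v) ->
  forall v, rnorm (phi v) <= rnorm v.
Proof.
move=> philin phi_le v.
pose f : {linear V -> K^o} :=
  HB.pack phi (GRing.isLinear.Build _ _ _ _ _ philin).
have phiZ (c : K) w : phi (c *: w) = c * phi w by exact: (linearZ_LR f).
have [phiv0|phiv0] := eqVneq (phi v) 0.
  by rewrite phiv0 rnorm0 rnorm_ge0.
pose c : K := `|phi v| / phi v.
have c1 : rnorm (c : K^o) = 1.
  by rewrite -[RHS](rnorm1 R k) /rnorm normf_div normr_id divff ?normr_eq0// normr1.
have := phi_le (c *: v).
by rewrite phiZ rnormZ c1 mul1r divfK.
Qed.

Lemma opnorm_has_sup (V W : normedModType K) (S : {linear V -> W}) :
  bounded_near S (nbhs (0 : V)) ->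
  has_sup [set rnorm (S v) | v in [set v | rnorm v <= 1]].
Proof.
move=> Sbd; split; first by exists (rnorm (S 0)), 0; rewrite //= rnorm0.
have /linear_boundedP/pinfty_ex_gt0[r r0 Sr] := Sbd.
exists (real_part r) => _ [v /= v1 <-].
apply: (le_trans (real_part_le (Sr v))); rewrite real_partM//; last exact: ltW.
by rewrite -[leRHS]mulr1 ler_wpM2l// -(real_part0 R k); exact/real_part_le/ltW.
Qed.

Lemma opnorm_upper_bound (V W : normedModType K) (S : {linear V -> W}) :
  bounded_near S (nbhs (0 : V)) ->
  forall v, rnorm v <= 1 -> rnorm (S v) <= opnorm S.
Proof.
by move=> Sbd v v1; apply: (sup_upper_bound (opnorm_has_sup Sbd)); exists v.
Qed.

Lemma opnorm_ge0 (V W : normedModType K) (S : {linear V -> W}) :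
  bounded_near S (nbhs (0 : V)) -> 0 <= opnorm S.
Proof.
move=> Sbd; rewrite (le_trans (rnorm_ge0 (S 0)))//.
by rewrite opnorm_upper_bound// rnorm0.
Qed.

Lemma opnorm_bound (V W : normedModType K) (S : {linear V -> W}) :
  has_sup [set rnorm (S v) | v in [set v | rnorm v <= 1]] ->
  forall v, rnorm (S v) <= opnorm S * rnorm v.
Proof.
move=> Ssup v; have [v0|v0] := eqVneq (rnorm v) 0.
  by rewrite v0 (rnorm_eq0 v0) linear0 rnorm0 mulr0.
have v_gt0 : 0 < rnorm v by rewrite lt_neqAle eq_sym v0 rnorm_ge0.
pose c := of_real k (rnorm v)^-1.
have normc (U : normedModType K) (w : U) : rnorm (c *: w) = (rnorm v)^-1 * rnorm w.
  by rewrite rnormZ rnorm_of_real ger0_norm// invr_ge0 ltW.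
rewrite -ler_pdivrMr// mulrC -normc -linearZ; apply: (sup_upper_bound Ssup).
by exists (c *: v); rewrite //= normc mulVf.
Qed.

Lemma dnorm_bound (E : normedModType K) (phi : dual E) (e : E) :
  rnorm (phi e) <= dnorm phi * rnorm e.
Proof.
pose f : {linear E -> K^o} :=
  HB.pack (val phi) (GRing.isLinear.Build _ _ _ _ _ (dual_linear phi)).
exact: (@opnorm_bound _ _ f (dnorm_has_sup phi)).
Qed.

Lemma bounded_linear_form_continuous (E : normedModType K) (phi : E -> K^o) :
  linear phi -> (forall e, rnorm (phi e) <= rnorm e) -> continuous phi.
Proof.
move=> philin phi_le.
pose f : {linear E -> K^o} :=
  HB.pack phi (GRing.isLinear.Build _ _ _ _ _ philin).
apply: (linear_bounded_continuous f).1; apply/linear_boundedP.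
exists 1; split=> // r r1 e; rewrite (le_trans (ler_rnorm (phi_le e)))//.
by rewrite ler_peMl// ltW.
Qed.

(** The norm is itself sublinear over the reals, so the Hahn-Banach theorem gives
    a real-linear form below the norm and equal to it at [e]; it is the real part
    of the functional sought. *)
Theorem exists_norming_form (E : normedModType K) (e : E) :
  exists2 phi : dual E, dnorm phi <= 1 & rnorm (phi e) = rnorm e.
Proof.
have [q [qlin q_le qe]] :=
  hahn_banach_sublinear (e : restrict_scalars E) (rnorm_sublinear E).
have [phi philin phiq] := linear_form_of_real_part qlin.
have phi_le v : rnorm (phi v) <= rnorm v.
  by apply: linear_form_rnorm_le => // {}v; rewrite phiq; exact: q_le.
have phi_dual : phi \in @is_continuous_form R k E.
  by rewrite inE; split=> //; exact: bounded_linear_form_continuous.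
exists (Dual phi_dual); first by apply: dnorm_le => v; exact: le_trans.
by apply/eqP; rewrite eq_le phi_le/= -[leLHS]qe -phiq real_part_le_rnorm.
Qed.

End Functionals.

(** * The least Lipschitz constant *)

Section LipschitzBound.
Variables (R : realType) (X : metricType R).

(** The infimum of the Lipschitz constants is itself one. When the distance of
    the points vanishes one cannot divide by it, but any constant then forces the
    left-hand side to be nonpositive. *)
Lemma Lip_bound (Y : Type) (d : Y -> Y -> R) (f : X -> Y) :
  lipschitz_const d f !=set0 ->
  forall x y, d (f x) (f y) <= Lip d f * mdist x y.
Proof.
move=> fLip x y; have [C [C0 fC]] := fLip.
have := mdist_ge0 x y; rewrite le_eqVlt => /predU1P[xy0|xy0].
  by rewrite -xy0 mulr0 (le_trans (fC x y))// -xy0 mulr0.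
rewrite -ler_pdivrMr//; apply: lb_le_inf => // D [_ fD].
by rewrite ler_pdivrMr.
Qed.

Lemma Lip_ge0 (Y : Type) (d : Y -> Y -> R) (f : X -> Y) :
  lipschitz_const d f !=set0 -> 0 <= Lip d f.
Proof. by move=> fLip; apply: lb_le_inf => // C []. Qed.

Lemma Lip_le (Y : Type) (d : Y -> Y -> R) (f : X -> Y) (C : R) :
  lipschitz_const d f C -> Lip d f <= C.
Proof. by move=> fC; apply: ge_inf => //; exists 0 => D []. Qed.

End LipschitzBound.

(** * The adjoint of a bounded operator *)

Section Adjoint.
Variables (R : realType) (k : scalar_kind).
Local Notation K := (scalars R k).
Variables (E : normedModType K) (S : {linear E -> E}).
Hypothesis Sbd : bounded_near S (nbhs (0 : E)).

Lemma adjoint_continuous_form (psi : dual E) :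
  (psi : E -> K^o) \o S \in @is_continuous_form R k E.
Proof.
rewrite inE; split=> [c u v|e]; first by rewrite /= linearP dual_linear.
apply: continuous_comp; last exact: dual_continuous.
exact: (linear_bounded_continuous S).1.
Qed.

Definition adjoint (psi : dual E) : dual E := Dual (adjoint_continuous_form psi).

Lemma adjointB (phi psi : dual E) :
  adjoint phi - adjoint psi = adjoint (phi - psi).
Proof. exact/val_inj. Qed.

Lemma dnorm_adjoint (psi : dual E) : dnorm (adjoint psi) <= dnorm psi * opnorm S.
Proof.
apply: dnorm_le => e e1; rewrite (le_trans (dnorm_bound psi (S e)))//.
by rewrite ler_wpM2l ?Defs.dnorm_ge0// opnorm_upper_bound.
Qed.

End Adjoint.

(** * The Lipschitz projective norm *)

Section ProjectiveNorm.
Variables (R : realType) (k : scalar_kind).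
Local Notation K := (scalars R k).
Variables (X : metricType R) (x0 : X) (E : normedModType K).
Local Notation T := (lip_tensor x0 E).
Local Notation Lipd := (Lip (@ddist R k E)).

Lemma lip_tensor_ext (u v : T) :
  (forall f, pairing u f = pairing v f) -> u = v.
Proof. by move=> uv; apply/val_inj/val_inj/funext. Qed.

Lemma delta_scale (c : K) (x y : X) (e : E) :
  delta x0 x y (c *: e) = c *: delta x0 x y e.
Proof.
apply: lip_tensor_ext => f.
pose fxy : {linear E -> K^o} := HB.pack (val (f x - f y : dual E))
  (GRing.isLinear.Build _ _ _ _ _ (dual_linear (f x - f y : dual E))).
exact: (linearZ_LR fxy c e).
Qed.

Lemma tensor_sum_scale (c : K) n (x y : 'I_n -> X) (e : 'I_n -> E) :
  tensor_sum x0 x y (fun i => c *: e i) = c *: tensor_sum x0 x y e.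
Proof. by rewrite scaler_sumr; apply: eq_bigr => i _; rewrite delta_scale. Qed.

Definition cat_family (A : Type) m n (f : 'I_m -> A) (g : 'I_n -> A)
  (i : 'I_(m + n)) : A :=
  match fintype.split i with inl j => f j | inr j => g j end.

Lemma cat_family_lshift (A : Type) m n (f : 'I_m -> A) (g : 'I_n -> A) j :
  cat_family f g (lshift n j) = f j.
Proof. by rewrite /cat_family (unsplitK (inl j)). Qed.

Lemma cat_family_rshift (A : Type) m n (f : 'I_m -> A) (g : 'I_n -> A) j :
  cat_family f g (rshift m j) = g j.
Proof. by rewrite /cat_family (unsplitK (inr j)). Qed.

Lemma tensor_sum_cat m n (x y : 'I_m -> X) (e : 'I_m -> E)
    (x' y' : 'I_n -> X) (e' : 'I_n -> E) :
  tensor_sum x0 (cat_family x x') (cat_family y y') (cat_family e e') =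
  tensor_sum x0 x y e + tensor_sum x0 x' y' e'.
Proof.
rewrite /tensor_sum big_split_ord/=.
by congr (_ + _); apply: eq_bigr => i _;
  rewrite ?cat_family_lshift ?cat_family_rshift.
Qed.

(** In a linear combination of elementary tensors the coefficients can be moved
    into the vectors. *)
Lemma exists_tensor_sum (u : T) :
  exists n (x y : 'I_n -> X) (e : 'I_n -> E), u = tensor_sum x0 x y e.
Proof.
have := valP u; rewrite inE => -[n [c [s [s_delta us]]]].
have /choice[t st] i : exists t : X * X * E, s i = delta_form x0 t.1.1 t.1.2 t.2.
  by have [x [y [e ->]]] := s_delta i; exists (x, y, e).
exists n, (fun i => (t i).1.1), (fun i => (t i).1.2), (fun i => c i *: (t i).2).
apply/val_inj; rewrite us /tensor_sum raddf_sum.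
by apply: eq_bigr => i _; rewrite [in RHS]delta_scale st.
Qed.

Definition proj_cost n (x y : 'I_n -> X) (e : 'I_n -> E) : R :=
  \sum_(i < n) mdist (x i) (y i) * rnorm (e i).

Lemma proj_cost_ge0 n (x y : 'I_n -> X) (e : 'I_n -> E) : 0 <= proj_cost x y e.
Proof. by apply: sumr_ge0 => i _; rewrite mulr_ge0// ?mdist_ge0 ?rnorm_ge0. Qed.

Lemma proj_norm_le n (x y : 'I_n -> X) (e : 'I_n -> E) :
  lip_proj_norm (tensor_sum x0 x y e) <= proj_cost x y e.
Proof.
apply: ge_inf; last by exists n, x, y, e.
by exists 0 => _ [m [x' [y' [e' [_ ->]]]]]; exact: proj_cost_ge0.
Qed.

(** A lower bound for all representations passes to the infimum. The factor [C]
    is part of the statement because it may vanish (a constant map, a zero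
    operator); that case rests on the existence of a representation. *)
Lemma le_scaled_proj_norm (C a : R) (u : T) : 0 <= C ->
  (forall n (x y : 'I_n -> X) (e : 'I_n -> E),
    u = tensor_sum x0 x y e -> a <= C * proj_cost x y e) ->
  a <= C * lip_proj_norm u.
Proof.
have [n [x [y [e ue]]]] := exists_tensor_sum u.
rewrite le_eqVlt => /predU1P[<- aC|C0 aC].
  by have := aC _ _ _ _ ue; rewrite !mul0r.
rewrite -ler_pdivrMl//; apply: lb_le_inf; first by exists (proj_cost x y e), n, x, y, e.
by move=> _ [m [x' [y' [e' [ue' ->]]]]]; rewrite ler_pdivrMl// aC.
Qed.

Lemma proj_norm_ge0 (u : T) : 0 <= lip_proj_norm u.
Proof.
rewrite -[leRHS]mul1r; apply: le_scaled_proj_norm => // n x y e _.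
by rewrite mul1r proj_cost_ge0.
Qed.

Lemma pairing_le_proj_norm (u : T) (f : lip0_dual x0 E) :
  rnorm (pairing u f : K^o) <= Lipd f * lip_proj_norm u.
Proof.
have := valP f; rewrite inE => -[fLip _].
apply: le_scaled_proj_norm => [|n x y e ->]; first exact: Lip_ge0.
rewrite pairing_tensor_sum mulr_sumr (le_trans (rnorm_sum _))//.
apply: ler_sum => i _; rewrite (le_trans (dnorm_bound _ _))// mulrA.
by rewrite ler_wpM2r ?rnorm_ge0// Lip_bound.
Qed.

Lemma proj_norm_eq0 (u : T) : lip_proj_norm u = 0 -> u = 0.
Proof.
move=> u0; apply: lip_tensor_ext => f; apply/rnorm_eq0/eqP.
rewrite eq_le rnorm_ge0 andbT (le_trans (pairing_le_proj_norm u f))//.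
by rewrite u0 mulr0.
Qed.

(** Applied to [c] and to its inverse, this gives equality. *)
Lemma proj_norm_scale_le (c : K) (u : T) :
  lip_proj_norm (c *: u) <= rnorm (c : K^o) * lip_proj_norm u.
Proof.
apply: le_scaled_proj_norm => [|n x y e ->]; first exact: rnorm_ge0.
rewrite -tensor_sum_scale (le_trans (proj_norm_le _ _ _))// mulr_sumr.
by apply: ler_sum => i _; rewrite rnormZ mulrCA.
Qed.

Lemma proj_norm_scale (c : K) (u : T) :
  lip_proj_norm (c *: u) = rnorm (c : K^o) * lip_proj_norm u.
Proof.
apply/eqP; rewrite eq_le proj_norm_scale_le/=.
have [->|c0] := eqVneq c 0; first by rewrite rnorm0 mul0r proj_norm_ge0.
have c1 : rnorm (c : K^o) * rnorm (c^-1 : K^o) = 1.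
  by rewrite -rnormZ [_ *: _]divff// rnorm1.
have := ler_wpM2l (rnorm_ge0 (c : K^o)) (proj_norm_scale_le c^-1 (c *: u)).
by rewrite scalerA mulVf// scale1r mulrA c1 mul1r.
Qed.

Lemma proj_normD (u v : T) :
  lip_proj_norm (u + v) <= lip_proj_norm u + lip_proj_norm v.
Proof.
rewrite -lerBlDr -[leRHS]mul1r; apply: le_scaled_proj_norm => // m x y e ue.
rewrite mul1r lerBlDr -lerBlDl -[leRHS]mul1r.
apply: le_scaled_proj_norm => // n x' y' e' ve'.
rewrite mul1r lerBlDl ue ve' -tensor_sum_cat (le_trans (proj_norm_le _ _ _))//.
rewrite /proj_cost big_split_ord/= lerD// ler_sum// => i _.
  by rewrite !cat_family_lshift.
by rewrite !cat_family_rshift.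
Qed.

Lemma proj_norm_is_norm : is_norm (@lip_proj_norm R k X x0 E).
Proof.
split; [exact: proj_norm_ge0|exact: proj_norm_eq0|exact: proj_norm_scale|].
exact: proj_normD.
Qed.

Lemma inj_norm_le_proj_norm (u : T) : lip_inj_norm u <= lip_proj_norm u.
Proof.
apply: ge_sup.
  exists (rnorm (pairing u 0 : K^o)), 0 => //=.
  rewrite (le_trans (Lip_le (C := 0) _))//; split=> // x y.
  by rewrite /ddist subrr dnorm0 mul0r.
move=> _ [f /= f1 <-]; rewrite (le_trans (pairing_le_proj_norm u f))//.
by rewrite ler_piMl ?proj_norm_ge0.
Qed.

Section RankOne.
Variables (g : X -> K^o) (phi : dual E).
Hypothesis g_lip0 : lip0 x0 (@ndist R k K^o) 0 g.

Lemma rank_one_lipschitz_const :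
  lipschitz_const (@ddist R k E) (fun x => (g x : K) *: phi)
    (Lip (@ndist R k K^o) g * dnorm phi).
Proof.
have [gLip _] := g_lip0; split=> [|x y].
  by rewrite mulr_ge0 ?Defs.dnorm_ge0 ?Lip_ge0.
rewrite /ddist -scalerBl -[X in dnorm X]addr0 (le_trans (dnorm_linear _ _ _))//.
by rewrite dnorm0 addr0 mulrAC ler_wpM2r ?Defs.dnorm_ge0//; exact: Lip_bound.
Qed.

Lemma rank_one_lip0_dual : (fun x => (g x : K) *: phi) \in @is_lip0_dual R k X x0 E.
Proof.
rewrite inE; split; first by eexists; exact: rank_one_lipschitz_const.
by rewrite g_lip0.2 scale0r.
Qed.

Definition rank_one : lip0_dual x0 E := Lip0Dual rank_one_lip0_dual.

Lemma pairing_rank_one n (x y : 'I_n -> X) (e : 'I_n -> E) :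
  pairing (tensor_sum x0 x y e) rank_one =
  \sum_(i < n) (g (x i) - g (y i)) * phi (e i).
Proof.
by rewrite pairing_tensor_sum; apply: eq_bigr => i _; rewrite -scalerBl.
Qed.

End RankOne.

Lemma proj_norm_dualizable : dualizable (@lip_proj_norm R k X x0 E).
Proof.
move=> g phi g_lip0 n x y e; rewrite -(pairing_rank_one phi g_lip0).
rewrite (le_trans (pairing_le_proj_norm _ _))// ler_wpM2r ?proj_norm_ge0//.
exact: Lip_le (rank_one_lipschitz_const _ _).
Qed.

(** The lower bound tests the tensor against the rank-one map
    (d(-, y) - d(x0, y)) phi, where phi is a norming functional of [e]: it is
    1-Lipschitz and its increment between [y] and [x] is d(x, y) phi. *)
Lemma proj_norm_delta (x y : X) (e : E) :
  lip_proj_norm (delta x0 x y e) = mdist x y * rnorm e.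
Proof.
have deltaE : delta x0 x y e =
    tensor_sum x0 (fun _ : 'I_1 => x) (fun=> y) (fun=> e).
  by rewrite /tensor_sum big_ord1.
apply/eqP; rewrite eq_le; apply/andP; split.
  by rewrite deltaE (le_trans (proj_norm_le _ _ _))// /proj_cost big_ord1.
have [phi phi1 phie] := exists_norming_form e.
pose g z : K^o := of_real k (mdist z y - mdist x0 y).
have g_const : lipschitz_const (@ndist R k K^o) g 1.
  split=> // z w; rewrite /ndist -rmorphB rnorm_of_real mul1r.
  rewrite opprB addrA subrK ler_norml.
  have := metric_triangle w z y; have := metric_triangle z w y.
  rewrite (metric_sym w z); lra.
have g_lip0 : lip0 x0 (@ndist R k K^o) 0 g.
  by split; [exists 1|rewrite /g subrr rmorph0].
have := @proj_norm_dualizable g phi g_lip0 1%N (fun=> x) (fun=> y) (fun=> e).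
rewrite big_ord1 -deltaE [_ * phi e]/((_ : K) *: (phi e : K^o)) rnormZ phie /g.
rewrite -rmorphB rnorm_of_real.
rewrite mdistxx opprB addrA subrK subr0 ger0_norm ?mdist_ge0// => /le_trans; apply.
rewrite ler_piMl ?proj_norm_ge0// mulr_ile1 ?Defs.dnorm_ge0 ?Lip_le//.
by rewrite Lip_ge0//; exists 1.
Qed.

Section Pullback.
Variables (h : X -> X) (S : {linear E -> E}).
Hypothesis h_lip0 : lip0 x0 mdist x0 h.
Hypothesis Sbd : bounded_near S (nbhs (0 : E)).

Lemma pullback_lip0_dual (f : lip0_dual x0 E) :
  (fun x => adjoint Sbd (f (h x))) \in @is_lip0_dual R k X x0 E.
Proof.
have := valP f; rewrite !inE => -[fLip f0]; have [hLip h0] := h_lip0.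
have S_ge0 := opnorm_ge0 Sbd.
split; last first.
  by rewrite h0 [f x0]f0; apply/val_inj/funext.
exists (Lipd f * Lip mdist h * opnorm S); split=> [|x y].
  by rewrite !mulr_ge0// Lip_ge0.
rewrite /ddist adjointB (le_trans (dnorm_adjoint _ _))// mulrAC ler_wpM2r//.
rewrite (le_trans (Lip_bound fLip _ _))// -mulrA ler_wpM2l ?Lip_ge0//.
exact: Lip_bound.
Qed.

Lemma pairing_pullback (f : lip0_dual x0 E) n (x y : 'I_n -> X) (e : 'I_n -> E) :
  pairing (tensor_sum x0 (h \o x) (h \o y) (S \o e)) f =
  pairing (tensor_sum x0 x y e) (Lip0Dual (pullback_lip0_dual f)).
Proof. by rewrite !pairing_tensor_sum. Qed.

(** The map [delta x y e |-> delta (h x) (h y) (S e)] is well defined on tensors,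
    being dual to the pullback of Lipschitz maps. *)
Lemma tensor_sum_map_eq m n (x y : 'I_m -> X) (e : 'I_m -> E)
    (x' y' : 'I_n -> X) (e' : 'I_n -> E) :
  tensor_sum x0 x y e = tensor_sum x0 x' y' e' ->
  tensor_sum x0 (h \o x) (h \o y) (S \o e) =
  tensor_sum x0 (h \o x') (h \o y') (S \o e').
Proof. by move=> ee'; apply: lip_tensor_ext => f; rewrite !pairing_pullback ee'. Qed.

End Pullback.

Lemma proj_norm_uniform : uniform_cross_norm (@lip_proj_norm R k X x0 E).
Proof.
move=> h S h_lip0 Sbd n x y e.
have S_le := opnorm_bound (opnorm_has_sup Sbd).
apply: le_scaled_proj_norm => [|m x' y' e' ee'].
  exact: mulr_ge0 (Lip_ge0 h_lip0.1) (opnorm_ge0 Sbd).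
rewrite (tensor_sum_map_eq h_lip0 Sbd ee') (le_trans (proj_norm_le _ _ _))//.
rewrite mulr_sumr; apply: ler_sum => i _; rewrite mulrACA.
apply: ler_pM; rewrite ?mdist_ge0 ?rnorm_ge0//; last exact: S_le.
exact: (Lip_bound h_lip0.1).
Qed.

End ProjectiveNorm.

Theorem theorem6p2 (R : realType) (k : scalar_kind) (X : metricType R) (x0 : X)
    (E : completeNormedModType (scalars R k)) :
  [/\ lip_cross_norm (@lip_proj_norm R k X x0 E),
      uniform_cross_norm (@lip_proj_norm R k X x0 E),
      dualizable (@lip_proj_norm R k X x0 E) &
      forall u : lip_tensor x0 E, lip_inj_norm u <= lip_proj_norm u].
Proof.
split.
- by split; [exact: proj_norm_is_norm|exact: proj_norm_delta].
- exact: proj_norm_uniform.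
- exact: proj_norm_dualizable.
- exact: inj_norm_le_proj_norm.
Qed.
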